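(* Let $\ell\ge 2$ be any fixed integer. Then for infinitely many primes $p$ there exists a non-empty subset $S\subseteq GF(p)$ for which $$|X_S(GF(p))|=\Big(2-\frac1\ell\Big)p+a$$ for some real number $a$ with $-\frac12\le a\le\frac52$.
   Context: For an odd prime $p$ and a non-empty subset $S\subseteq GF(p)$ let $f_S(x)=\prod_{a\in S}(x-a)\in GF(p)[x]$, and let $X_S$ be the hyperelliptic curve $y^2=f_S(x)$. $|X_S(GF(p))|$ denotes the number of solutions $(x,y)\in GF(p)^2$ of $y^2=f_S(x)$ plus the number of points at infinity, which is $2$ if $|S|$ is even and $1$ if $|S|$ is odd. *)

(* Defs.v *)
From HB Require Import structures.
From mathcomp Require Import all_boot all_order all_algebra.

Set Implicit Arguments.
Unset Strict Implicit.
Unset Printing Implicit Defensive.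

Import GRing.Theory.
Local Open Scope ring_scope.

(* 'F_p is GF(p) only when p is prime. *)

Definition fS (p : nat) (S : {set 'F_p}) : {poly 'F_p} :=
  \prod_(a in S) ('X - a%:P).

Definition affine_points (p : nat) (S : {set 'F_p}) : {set 'F_p * 'F_p} :=
  [set xy | xy.2 ^+ 2 == (fS S).[xy.1]].

Definition points_at_infinity (p : nat) (S : {set 'F_p}) : nat :=
  if odd #|S| then 1 else 2.

Definition card_XS (p : nat) (S : {set 'F_p}) : nat :=
  (#|affine_points S| + points_at_infinity S)%N.

(* Main.v *)
(* Take S to be the group of m-th roots of unity in GF(p), with p = l m + 1, so
   that f_S = X^m - 1.  At x <> 0 the power x^m is an l-th root of unity, and at
   0 the value is -1; hence f_S takes only square values as soon as p = 1 mod 4l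
   and w^j - 1 is a square for every power w^j of a primitive 4l-th root of
   unity w.  Then the curve has m + 2(p - m) affine points, and a is 1/l plus the
   number of points at infinity.

   Such primes are found by reduction from the algebraic numbers.  Choose z with
   Q(z) containing a primitive 4l-th root of unity zeta and all the
   1/sqrt(zeta^j - 1), and let M be its primitive minimal polynomial over Z.  By
   Gauss's lemma every integer polynomial vanishing at z vanishes at any root of
   M mod p, so it is enough that M has a root modulo infinitely many primes.
   Passing to the inverses 1/sqrt(zeta^j - 1) also forces the image of zeta^j to
   differ from 1, so that the image of zeta is still primitive. *)
Require Import Defs.
From mathcomp Require Import all_boot all_order all_algebra all_solvable all_field.
From mathcomp Require Import classical_sets cardinality reals.
From mathcomp Require Import zify ring lra.
Set Implicit Arguments.
Unset Strict Implicit.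
Unset Printing Implicit Defensive.
Import Order.TTheory GRing.Theory Num.Theory.
Local Open Scope ring_scope.

(** * Reduction of algebraic numbers modulo large primes *)

Lemma poly_int_prime_divisor (M : {poly int}) (N : nat) :
  (1 < size M)%N ->
  exists p : nat, [/\ prime p, (N < p)%N & exists n : int, (p %| M.[n])%Z].
Proof.
(* Euclid: M(c N! t) = c g with g = 1 mod N!, so prime factors of g exceed N. *)
move=> M_gt1; have [c0|c_neq0] := eqVneq M.[0] 0.
  have [p ltNp p_pr] := prime_above N.
  by exists p; split=> //; exists 0; rewrite c0 dvdz0.
set c := M.[0] in c_neq0.
have [Q defM] : exists Q, M = Q * 'X + c%:P.
  have /factor_theorem[Q eqQ] : root (M - c%:P) 0 by rewrite rootE !hornerE subrr.
  by exists Q; move/eqP: eqQ; rewrite subr0 subr_eq => /eqP.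
pose k : int := c * N`!%:Z.
have k_neq0 : k != 0 by rewrite mulf_neq0 // -lt0n fact_gt0.
have shift_neq0 d : M + d%:P != 0.
  have lt_dM : (size d%:P < size M)%N.
    exact: leq_ltn_trans (size_polyC_leq1 d) M_gt1.
  by rewrite -size_poly_gt0 size_polyDl // ltnW.
(* Where [H] is nonzero, [M] takes none of the values [0], [c], [- c], so the cofactor [g] is not
   [0], [1] or [-1] and has a prime divisor. *)
pose H := M * (M + c%:P) * (M + (- c)%:P).
have H_neq0 : H != 0.
  by rewrite !mulf_neq0 ?shift_neq0 // -size_poly_gt0 ltnW.
pose rs := [seq k * t%:Z | t <- iota 0 (size H)].
have rs_uniq : uniq rs.
  rewrite map_inj_uniq ?iota_uniq // => t u /(mulfI k_neq0) [] //.
have [all_rs|/allPn[_ /mapP[t _ ->]] ntH] := boolP (all (root H) rs).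
  by have := max_poly_roots H_neq0 all_rs rs_uniq; rewrite size_map size_iota ltnn.
pose g := Q.[k * t%:Z] * (N`!%:Z * t%:Z) + 1.
have Mg : M.[k * t%:Z] = c * g.
  rewrite defM hornerD hornerM hornerX hornerC /g /k; ring.
have [g_gt1|] := ltnP 1 `|g|%N; last first.
  move=> g_le1; have g_small : [\/ g = 0, g = 1 | g = -1].
    by case: (g) g_le1 => [[|[|//]]|[|//]] _; [apply: Or31|apply: Or32|apply: Or33].
  case/negP: ntH; rewrite rootE !hornerM !hornerD !hornerC Mg.
  by case: g_small => ->; rewrite ?mulr0 ?mul0r // ?mulr1 ?mulrN1 ?subrr ?addNr ?mulr0 ?mul0r.
have [p p_pr pg] := pdivP g_gt1.
exists p; split=> //; last by exists (k * t%:Z); rewrite Mg dvdz_mull // dvdzE.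
rewrite ltnNge; apply/negP=> le_pN.
have pK : (p %| N`!%:Z)%Z by rewrite dvdzE dvdn_fact // prime_gt0.
have: (p %| g - Q.[k * t%:Z] * (N`!%:Z * t%:Z))%Z.
  by apply: rpredB; [rewrite dvdzE | apply: dvdz_mull; apply: dvdz_mulr].
by rewrite addrC addKr dvdzE dvdn1 => /eqP p1; move: p_pr; rewrite -[p]/`|p|%N p1.
Qed.

(** A single [x] serves every [F], so sending [z] to [x] is a ring morphism from Z[z] to ['F_p],
    carrying all integer relations on [z] along at once. *)
Lemma algC_reduction_mod_prime (z : algC) (N : nat) :
  exists p : nat, [/\ prime p, (N < p)%N &
    exists x : 'F_p, forall F : {poly int},
      root (map_poly intr F) z -> root (map_poly intr F) x].
Proof.
have [q [_ mon_q] zq] := minCpolyP z.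
have [M [a a_neq0 defq]] := rat_poly_scale q.
have a_neq0' : a%:~R^-1 != 0 :> rat by rewrite invr_eq0 intr_eq0.
have M_gt1 : (1 < size (zprimitive M))%N.
  rewrite size_zprimitive -size_rat_int_poly -(size_scale _ a_neq0') -defq.
  have /root_size_gt1 : root (map_poly ratr q) z by rewrite zq.
  by rewrite size_map_poly map_poly_eq0; apply; apply: monic_neq0.
have [p [p_pr ltNp [n pMn]]] := poly_int_prime_divisor N M_gt1.
exists p; split=> //; exists n%:~R => F rootF.
have : M %| F.
  rewrite -dvdp_rat_int -(dvdpZl _ _ a_neq0') -defq -zq.
  rewrite -map_poly_comp /= (eq_map_poly (g := intr)) // => i.
  exact: ratr_int.
case/dvdpP_int=> r ->.
rewrite rootE horner_map hornerM /= intrM mulf_eq0.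
by rewrite -(dvdz_pcharf (pchar_Fp p_pr)) pMn.
Qed.

(** The hypothesis is [(n / d) ^+ 2 * (A / B - 1) = 1] cleared of denominators, the form in which it
    passes from [algC] to ['F_p]. *)
Lemma ratio_sub1_square (F : fieldType) (n d A B : F) :
  B != 0 -> d != 0 -> n ^+ 2 * (A - B) = d ^+ 2 * B ->
  exists2 y, y != 0 & A / B - 1 = y ^+ 2.
Proof.
move=> B_neq0 d_neq0 eqAB.
have n_neq0 : n != 0.
  apply/eqP=> n0; move/esym/eqP: eqAB; rewrite n0 expr0n mul0r.
  by rewrite mulf_eq0 expf_eq0 /= (negPf d_neq0) (negPf B_neq0).
exists (d / n); first by rewrite mulf_neq0 ?invr_eq0.
rewrite (_ : A / B - 1 = n ^+ 2 * (A - B) / (n ^+ 2 * B)); last first.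
  by field; apply/andP.
by rewrite eqAB; field; apply/andP.
Qed.

Lemma prime_shifted_unity_roots_square (L N : nat) :
  (0 < L)%N ->
  exists p : nat, [/\ prime p, (N < p)%N &
    exists w : 'F_p, L.-primitive_root w /\
      forall j, exists y, w ^+ j - 1 = y ^+ 2].
Proof.
move=> L_gt0; have [zeta prim_zeta] := C_prim_root_exists L_gt0.
have [z _ [ps Dps]] :=
  algC_PET (zeta :: [seq (sqrtC (zeta ^+ j - 1))^-1 | j <- iota 0 L]).
pose num q : {poly int} := tag (rat_poly_scale q).
pose den q : int := s2val (tagged (rat_poly_scale q)).
have den_neq0 q : den q != 0 by rewrite /den; case: (tagged _).
have ratE q : (map_poly ratr q).[z] = (map_poly intr (num q)).[z] / (den q)%:~R.
  have Dq : q = (den q)%:~R^-1 *: map_poly intr (num q).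
    by rewrite /den /num; case: (rat_poly_scale q) => ? [].
  rewrite {1}Dq map_polyZ hornerZ mulrC fmorphV rmorph_int /= -map_poly_comp.
  by congr (_.[_] / _); apply: eq_map_poly => i /=; rewrite ratr_int.
(* The bound makes [p] exceed every denominator, so that all of them stay invertible in ['F_p]. *)
have [p [p_pr ltNp [x xP]]] :=
  algC_reduction_mod_prime z (N + \sum_(q <- ps) `|den q|).
exists p; split=> //; first by lia.
have Fp_int (a : int) : (0 < `|a| < p)%N -> a%:~R != 0 :> 'F_p.
  move=> /andP[a_gt0 ltap]; rewrite -(dvdz_pcharf (pchar_Fp p_pr)) dvdzE.
  by rewrite gtnNdvd.
have den_Fp q : q \in ps -> (den q)%:~R != 0 :> 'F_p.
  move=> ps_q; apply: Fp_int; rewrite absz_gt0 den_neq0 /=.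
  apply: leq_ltn_trans ltNp; rewrite (big_rem q) //=; lia.
pose w : 'F_p := (map_poly intr (num ps`_0)).[x] / (den ps`_0)%:~R.
have size_ps : size ps = L.+1.
  rewrite -(size_map (fun q => (map_poly ratr q).[z])) -Dps /=.
  by rewrite size_map size_iota.
have zetaE : zeta = (map_poly ratr ps`_0).[z].
  by have := congr1 (nth 0 ^~ 0) Dps; rewrite /= (nth_map 0) ?size_ps.
have sE j : (j < L)%N ->
    (sqrtC (zeta ^+ j - 1))^-1 = (map_poly ratr ps`_j.+1).[z].
  move=> ltjL; have := congr1 (nth 0 ^~ j.+1) Dps.
  by rewrite /= (nth_map 0) ?size_iota // nth_iota // (nth_map 0) // size_ps.
have num_zeta : (map_poly intr (num ps`_0)).[z] = zeta * (den ps`_0)%:~R.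
  by rewrite zetaE ratE divfK // intr_eq0.
have den_w : (den ps`_0)%:~R != 0 :> 'F_p.
  by apply/den_Fp/mem_nth; rewrite size_ps.
have wL : w ^+ L = 1.
  have := xP (num ps`_0 ^+ L - (den ps`_0 ^+ L)%:P).
  rewrite !rootE !rmorphB !rmorphXn /= !map_polyC !hornerD !hornerN.
  rewrite !horner_exp !hornerC /= num_zeta exprMn.
  rewrite (prim_expr_order prim_zeta) mul1r subrr eqxx => /(_ isT).
  rewrite subr_eq0 => /eqP wL.
  by rewrite expr_div_n wL divff // expf_neq0.
have wj j : (0 < j < L)%N -> exists2 y, y != 0 & w ^+ j - 1 = y ^+ 2.
  case/andP=> j_gt0 ltjL; set q := ps`_j.+1.
  have den_q : (den q)%:~R != 0 :> 'F_p.
    by apply/den_Fp/mem_nth; rewrite size_ps.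
  set a := zeta ^+ j - 1.
  have a_neq0 : a != 0.
    by rewrite subr_eq0 -(prim_order_dvd prim_zeta) gtnNdvd.
  have num_q : (map_poly intr (num q)).[z] = (sqrtC a)^-1 * (den q)%:~R.
    by rewrite sE // ratE divfK // intr_eq0.
  (* This encodes [s ^+ 2 * (zeta ^+ j - 1) = 1] for [s = (sqrtC a)^-1], without denominators. *)
  pose F := num q ^+ 2 * (num ps`_0 ^+ j - (den ps`_0 ^+ j)%:P)
            - (den q ^+ 2 * den ps`_0 ^+ j)%:P.
  have FE (R : comNzRingType) (t : R) : (map_poly intr F).[t] =
      (map_poly intr (num q)).[t] ^+ 2
      * ((map_poly intr (num ps`_0)).[t] ^+ j - (den ps`_0)%:~R ^+ j)
      - (den q)%:~R ^+ 2 * (den ps`_0)%:~R ^+ j.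
    rewrite !(rmorphB, rmorphM, rmorphXn) /= !map_polyC.
    by rewrite !(hornerD, hornerN, hornerM, horner_exp, hornerC).
  have /xP : root (map_poly intr F) z.
    rewrite rootE FE num_zeta num_q !exprMn exprVn sqrtCK.
    by apply/eqP; rewrite /a in a_neq0 *; field.
  rewrite rootE FE subr_eq0 => /eqP eqAB.
  have [y y_neq0 Dy] := ratio_sub1_square (expf_neq0 j den_w) den_q eqAB.
  by exists y => //; rewrite /w expr_div_n.
have prim_w : L.-primitive_root w.
  have [m prim_m mL] := prim_order_exists L_gt0 wL.
  have [ltmL||<- //] := ltngtP m L; last by rewrite ltnNge dvdn_leq.
  have [|y y_neq0] := wj m; first by rewrite (prim_order_gt0 prim_m).
  rewrite (prim_expr_order prim_m) subrr => /esym/eqP.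
  by rewrite sqrf_eq0 (negPf y_neq0).
exists w; split=> // j; rewrite -(prim_expr_mod prim_w).
have [->|] := posnP (j %% L); first by exists 0; rewrite expr0 subrr expr0n.
move=> j_gt0; have [|y _ ->] := wj (j %% L)%N; last by exists y.
by rewrite j_gt0 ltn_mod.
Qed.

(** * Point counts and roots of unity in the prime field *)

(** The fibre over [x] has one point if [x] is in [S] and two otherwise, so counting the elements of
    [S] once more gives 2 for every [x]. *)
Lemma card_affine_points_squares (p : nat) (S : {set 'F_p}) :
  prime p -> odd p -> (forall x, exists y, (fS S).[x] = y ^+ 2) ->
  (#|affine_points S| + #|S|)%N = p.*2.
Proof.
move=> p_pr p_odd sqf.
have rootS x : ((fS S).[x] == 0) = (x \in S).
  rewrite horner_prod; apply/prodf_eq0/idP => [[a aS]|xS].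
    by rewrite hornerXsubC subr_eq0 => /eqP->.
  by exists x => //; rewrite hornerXsubC subrr.
have two_neq0 : 2%:R != 0 :> 'F_p.
  rewrite -(dvdn_pcharf (pchar_Fp p_pr)) dvdn_prime2 //.
  by apply: contraTneq p_odd => ->.
transitivity (\sum_(x : 'F_p)
    (#|[set y : 'F_p | y ^+ 2 == (fS S).[x]]| + (x \in S)))%N.
  rewrite big_split /=; congr (_ + _)%N; last by rewrite -sum1_card big_mkcond.
  rewrite -sum1_card
    (eq_bigl (fun xy => xy.2 ^+ 2 == (fS S).[xy.1])); last first.
    by move=> xy; rewrite inE.
  rewrite -(pair_big_dep xpredT
    (fun x y => y ^+ 2 == (fS S).[x]) (fun _ _ => 1%N)) /=.
  by apply: eq_bigr => x _; rewrite -sum1_card; apply: eq_bigl => y; rewrite inE.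
transitivity (\sum_(x : 'F_p) 2)%N; last by rewrite sum_nat_const card_Fp // muln2.
apply: eq_bigr => x _.
have [y fx] := sqf x; rewrite -rootS fx sqrf_eq0.
have [->|y_neq0] := eqVneq y 0.
  rewrite (_ : [set _ | _] = [set 0]) ?cards1 //.
  by apply/setP => u; rewrite !inE expr0n sqrf_eq0.
rewrite (_ : [set _ | _] = [set y; - y]) ?cards2.
  by rewrite -addr_eq0 -mulr2n -mulr_natl mulf_eq0 negb_or two_neq0 y_neq0.
by apply/setP => u; rewrite !inE eqf_sqr.
Qed.

Lemma Fp_expf_pred (p : nat) (x : 'F_p) : prime p -> x != 0 -> x ^+ p.-1 = 1.
Proof.
move=> p_pr x_neq0; apply: (mulfI x_neq0).
by rewrite -exprS prednK ?prime_gt0 // mulr1 -{2}(expf_card x) card_Fp.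
Qed.

Lemma fS_unity_roots (p m : nat) (S := [set x : 'F_p | x ^+ m == 1]) :
  prime p -> (m %| p.-1)%N -> fS S = 'X^m - 1 /\ #|S| = m.
Proof.
move=> p_pr m_dvd.
have p1_gt0 : (0 < p.-1)%N by rewrite -subn1 subn_gt0 prime_gt1.
have /hasP[g _ prim_g] :
    has p.-1.-primitive_root (enum [pred x : 'F_p | x != 0]).
  apply: has_prim_root => //; rewrite ?enum_uniq //.
    apply/allP=> x; rewrite mem_enum inE => x_neq0.
    by rewrite unity_rootE Fp_expf_pred.
  by rewrite -cardE cardC1 card_Fp.
have prim_h := dvdn_prim_root prim_g m_dvd.
set h := g ^+ _ in prim_h; pose rs := [seq h ^+ i | i <- index_iota 0 m].
have S_rs : S =i rs.
  move=> x; rewrite inE; apply/eqP/mapP => [/(prim_rootP prim_h)[i ->]|[i _ ->]].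
    by exists (val i) => //; rewrite mem_index_iota ltn_ord.
  by rewrite exprAC (prim_expr_order prim_h) expr1n.
have rs_uniq : uniq rs.
  rewrite map_inj_in_uniq ?iota_uniq // => i j.
  rewrite !mem_index_iota => /andP[_ lt_im] /andP[_ lt_jm] /eqP.
  by rewrite (eq_prim_root_expr prim_h) !modn_small // => /eqP.
split; last first.
  by rewrite (eq_card S_rs) (card_uniqP rs_uniq) size_map size_iota subn0.
rewrite -(factor_Xn_sub_1 prim_h) /fS (eq_bigl _ _ S_rs) -big_uniq //.
by rewrite big_map.
Qed.

Lemma prime_fS_unity_roots_square (l N : nat) :
  (0 < l)%N ->
  exists p : nat, [/\ prime p, odd p, (N < p)%N & exists m,
    p = (l * m).+1 /\ let S := [set x : 'F_p | x ^+ m == 1] in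
      #|S| = m /\ forall x, exists y, (fS S).[x] = y ^+ 2].
Proof.
move=> l_gt0; have L_gt0 : (0 < 4 * l)%N by rewrite muln_gt0.
(* The extra 2 makes [p] odd. *)
have [p [p_pr ltNp [w [prim_w sqw]]]] :=
  prime_shifted_unity_roots_square (N + 2) L_gt0.
have w_neq0 : w != 0.
  apply/eqP=> w0; have /eqP := prim_expr_order prim_w.
  by rewrite w0 expr0n eqn0Ngt L_gt0 eq_sym oner_eq0.
have /dvdnP[k Dk] : (4 * l %| p.-1)%N.
  by rewrite (prim_order_dvd prim_w) Fp_expf_pred.
have Dp : p = (l * (4 * k)).+1.
  by rewrite -[LHS]prednK ?prime_gt0 // Dk; lia.
exists p; split; rewrite ?(ltn_trans _ ltNp) //; try lia.
exists (4 * k)%N; split=> // S.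
have [-> ->] : fS S = 'X^(4 * k) - 1 /\ #|S| = (4 * k)%N.
  by apply: fS_unity_roots => //; rewrite Dk; apply/dvdnP; exists l; lia.
split=> // x; rewrite !hornerE.
have [->|x_neq0] := eqVneq x 0.
  (* The value at 0 is -1, and [w ^+ (l * 2)] is a square root of 1 other than 1, hence -1. *)
  exists (w ^+ l); rewrite expr0n.
  have k_gt0 : (0 < k)%N by have := prime_gt1 p_pr; case: (k) Dk => //; lia.
  have /eqP : (w ^+ (l * 2)) ^+ 2 = 1.
    by rewrite -exprM -mulnA mulnC (prim_expr_order prim_w).
  rewrite muln_eq0 /= eqn0Ngt k_gt0 sub0r sqrf_eq1 -exprM.
  case/orP=> [|/eqP-> //].
  by rewrite -(prim_order_dvd prim_w) gtnNdvd //; lia.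
(* [x ^+ (4 * k)] is a [4 * l]-th root of unity by Fermat, hence a power of [w]. *)
have [i ->] : {i : 'I_(4 * l) | x ^+ (4 * k) = w ^+ i}.
  apply: (prim_rootP prim_w); rewrite -exprM.
  rewrite (_ : 4 * k * (4 * l) = p.-1 * 4)%N; last by rewrite Dk; lia.
  by rewrite exprM Fp_expf_pred // expr1n.
exact: sqw.
Qed.

Local Open Scope classical_set_scope.
Local Open Scope ring_scope.

Theorem theorem7 (R : realType) (l : nat) (hl : (2 <= l)%N) :
  infinite_set
    [set p : nat |
       [/\ prime p, odd p &
           exists S : {set 'F_p},
             S != finset.set0 /\
             exists a : R,
               - (1 / 2) <= a <= 5 / 2 /\
               (card_XS S)%:R = (2 - 1 / l%:R) * p%:R + a]].
Proof.
move=> /finite_seqP[s Ds].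
have l_gt0 : (0 < l)%N by exact: ltnW.
have [p [p_pr p_odd ltNp [m [Dp [cardS sqS]]]]] :=
  prime_fS_unity_roots_square (\max_(q <- s) q) l_gt0.
set S := [set x | _]%SET in cardS sqS.
(* [s] lists the supposedly finite set, and [p] was chosen above its maximum. *)
suff p_in_s : p \in s by move: ltNp; rewrite (big_rem p) //= gtn_max ltnn.
suff : [set` s] p by [].
rewrite -Ds /=; split=> //; exists S; split.
  rewrite -finset.card_gt0 cardS.
  by have := prime_gt1 p_pr; rewrite Dp; case: (m) => //; rewrite muln0.
(* Since m = (p - 1)/l, 2p - m = (2 - 1/l)p + 1/l; and 1/l is at most 1/2, so this value is at most
   5/2. *)
exists (l%:R^-1 + (points_at_infinity S)%:R); split.
  have l_inv : 0 <= (l%:R : R)^-1 <= 2^-1.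
    by rewrite invr_ge0 ler0n lef_pV2 ?posrE ?ltr0n // ler_nat.
  have [->|->] : points_at_infinity S = 1%N \/ points_at_infinity S = 2%N.
  - by rewrite /points_at_infinity; case: ifP; [left|right].
  - by lra.
  - by lra.
have := card_affine_points_squares p_pr p_odd sqS; rewrite cardS => cardA.
have -> : card_XS S = (p.*2 - m + points_at_infinity S)%N.
  by rewrite -cardA addnK.
rewrite natrD natrB; last by rewrite -cardA leq_addl.
rewrite -muln2 natrM.
have -> : p%:R = l%:R * m%:R + 1 :> R by rewrite -natrM natr1 -Dp.
by field; rewrite pnatr_eq0 -lt0n.
Qed.
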